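(* Consider any one of the procedures FS, LAR, or lasso, run for $k$ steps on data $(X,y)$, with selected model $\hat M(X,y)$. Then $\hat M(X,y)$ depends on $(X,y)$ only through the master statistic $\Omega_n=\big(\frac1n X^TX,\frac{1}{\sqrt n}X^Ty\big)$. In more detail: for any fixed $M\in\mathcal M$, the matrix $Q_M(X)$ such that $\hat M(X,y)=M \iff Q_M(X)\,y\ge 0$ (componentwise) can be written as $Q_M(X)=P_M\big(\frac1n X^TX\big)\,\frac{1}{\sqrt n}X^T$, where the matrix $P_M=P_M(\frac1nX^TX)$ depends only on $\frac1n X^TX$ (and on $M$). Hence $$\hat M(X,y)=M\iff P_M\Big(\frac1n X^TX\Big)\frac{1}{\sqrt n}X^Ty\ge 0 .$$
   Context: **Setup.** $X\in\mathbb R^{n\times d}$ has columns $X_1,\dots,X_d$; $y\in\mathbb R^n$; $k\ge 1$ is a fixed number of steps. For an ordered list $A$ of distinct indices, $X_A$ is the matrix with these columns and $P_A^\perp=I-X_A(X_A^TX_A)^{-1}X_A^T$ ($=I$ if $A=\emptyset$). All inverses and reciprocals written below are assumed to exist. Inequalities between vectors are componentwise. **Procedures and selected models.** Each procedure starts from $A_0=\emptyset$ and produces active lists $A_1,\dots,A_k$ and sign vectors $s_\ell\in\{-1,1\}^{|A_\ell|}$, which are the signs of the least squares coefficients on the active variables: $\mathrm{diag}(s_\ell)(X_{A_\ell}^TX_{A_\ell})^{-1}X_{A_\ell}^Ty\ge 0$, $\ell=1,\dots,k$. *FS (forward stepwise).* $A_\ell=(A_{\ell-1},j_\ell)$ where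 $j_\ell\notin A_{\ell-1}$ satisfies, with $P=P^\perp_{A_{\ell-1}}$ and $s_{\ell,\ell}$ the last entry of $s_\ell$, $s_{\ell,\ell}\,X_{j_\ell}^TPy/\|PX_{j_\ell}\|_2^2\ \ge\ \pm X_j^TPy/\|PX_j\|_2^2$ for all $j\notin A_\ell$. The model is $M=\{(A_\ell,s_\ell):\ell=1,\dots,k\}$. *LAR (least angle regression).* One also tracks entry signs $\sigma_{\ell}\in\{-1,1\}^{|A_\ell|}$ and knots $\lambda_0=+\infty\ge\lambda_1\ge\cdots\ge\lambda_k\ge0$. At step $\ell$, with $A=A_{\ell-1}$, $\sigma=\sigma_{\ell-1}$, put, for $j\notin A$ and $s\in\{-1,1\}$, $c_\ell(j,s)=P_A^\perp X_j/\big(s-X_j^TX_A(X_A^TX_A)^{-1}\sigma\big)$. The eligible pairs are those $(j,s)$ with $c_\ell(j,s)^Ty\le\lambda_{\ell-1}$ (ineligible ones satisfy $\ge$); the pair $(j_\ell,s'_\ell)$ maximizing $c_\ell(j,s)^Ty$ over eligible pairs enters, $\lambda_\ell$ is this maximum, $A_\ell=(A,j_\ell)$, $\sigma_\ell=(\sigma,s'_\ell)$. The extra information $I_\ell$ is the set of eligible pairs together with the entering pair. The model is $M=\{(A_\ell,s_\ell,I_\ell):\ell=1,\dots,k\}$. *Lasso.* As LAR, but at step $\ell$ there are also crossing candidates $j\in A=A_{\ell-1}$ with $d_\ell(j)=X_A(X_A^TX_A)^{-1}e_j/\big(e_j^T(X_A^TX_A)^{-1}\sigma\big)$ ($e_j$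 the basis vector at the position of $j$ in $A$), eligible if $d_\ell(j)^Ty\le\lambda_{\ell-1}$ (ineligible ones satisfy $\ge$). A variable that joined at step $\ell-1$ is not a crossing candidate at step $\ell$, and a variable that left at step $\ell-1$ is not a joining candidate at step $\ell$ with the sign it had. $\lambda_\ell\ge 0$ is the maximum of all eligible $c_\ell(j,s)^Ty$ and $d_\ell(j)^Ty$; if attained by a joining pair it is appended, if attained by a crossing variable that variable and its sign are removed. $I_\ell$ is the set of eligible joining pairs, the set of eligible crossing variables, and the event (join/leave) that occurs. The model is $M=\{(A_\ell,s_\ell,I_\ell)\}_{\ell=1}^k$. **Selection event.** $\mathcal M$ is the finite set of possible models. For fixed $M$ all the conditions above are linear inequalities in $y$; $\hat M(X,y)=M$ means that all of these (weak) inequalities hold (so different models can coincide only at ties). $Q_M(X)$ is the matrix whose rows give these inequalities (rows being determined up to positive scaling), so $\hat M(X,y)=M\iff Q_M(X)y\ge0$. *)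

(* Defs.v *)
(* Mathematical Components, with extended reals from MathComp-Analysis. *)
From HB Require Import structures.
From mathcomp Require Import all_boot all_order all_algebra.
From mathcomp Require Import constructive_ereal.
Set Implicit Arguments.
Unset Strict Implicit.
Unset Printing Implicit Defensive.
Import Order.TTheory GRing.Theory Num.Theory.
Local Open Scope ring_scope.

(* Throughout, a sign is a boolean b standing for (-1) ^+ b, so false is +1
   and true is -1; steps are numbered from 1 to k, and step l = i + 1 is
   indexed by i : 'I_k. *)

Inductive procedure := FS | LAR | Lasso.

Section LinearAlgebra.
Variables (R : rcfType) (d : nat).

Definition Xsub n (X : 'M[R]_(n, d)) (A : seq 'I_d) : 'M[R]_(n, size A) :=
  colsub (tnth (in_tuple A)) X.

Definition gram n (X : 'M[R]_(n, d)) (A : seq 'I_d) : 'M[R]_(size A) :=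
  (Xsub X A)^T *m Xsub X A.

(* Equal to 1%:M when A = [::], the subtracted term being a product through
   dimension 0. *)
Definition Pperp n (X : 'M[R]_(n, d)) (A : seq 'I_d) : 'M[R]_n :=
  1%:M - Xsub X A *m invmx (gram X A) *m (Xsub X A)^T.

Definition sign_col (s : seq bool) m : 'cV[R]_m :=
  \col_a (-1) ^+ nth false s a.

Definition dot n (u v : 'cV[R]_n) : R := (u^T *m v) 0 0.

Definition nonneg m (v : 'cV[R]_m) : Prop := forall a, 0 <= v a 0.

(* The matrix diag(s) (X_A^T X_A)^-1 X_A^T. *)
Definition signed_ls n (X : 'M[R]_(n, d)) (A : seq 'I_d) (s : seq bool)
    : 'M[R]_(size A, n) :=
  diag_mx (sign_col s (size A))^T *m invmx (gram X A) *m (Xsub X A)^T.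

(* An inequality 0 <= q(X) *m y, as its coefficient row q(X); since q is
   defined for all sample sizes, the number of rows of a list of such
   inequalities does not involve n. *)
Definition design_row := forall n, 'M[R]_(n, d) -> 'rV[R]_n.

Definition signed_ls_rows (A : seq 'I_d) (s : seq bool) : seq design_row :=
  [seq (fun n (X : 'M[R]_(n, d)) => row a (signed_ls X A s))
  | a <- enum 'I_(size A)].

Definition rows_mx (L : seq design_row) n (X : 'M[R]_(n, d))
    : 'M[R]_(size L, n) :=
  \matrix_(i < size L) tnth (in_tuple L) i n X.

Definition same_up_to_pos_row_scaling m n (Q Q' : 'M[R]_(m, n)) : Prop :=
  exists2 c : 'rV[R]_m, (forall i, 0 < c 0 i) & Q' = diag_mx c *m Q.

Definition scaled_gram n (X : 'M[R]_(n, d)) : 'M[R]_d :=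
  n%:R^-1 *: (X^T *m X).

Definition scaled_score n (X : 'M[R]_(n, d)) (y : 'cV[R]_n) : 'cV[R]_d :=
  (Num.sqrt n%:R)^-1 *: (X^T *m y).

Definition master_statistic n (X : 'M[R]_(n, d)) (y : 'cV[R]_n)
    : 'M[R]_d * 'cV[R]_d :=
  (scaled_gram X, scaled_score X y).

End LinearAlgebra.

Section Models.
Variables (d k : nat).

(* inl (j, s): the variable j joins with sign s; inr j: j leaves. *)
Definition candidate : Type := (('I_d * bool) + 'I_d)%type.

(* The extra information at a step: the set of eligible candidates, and the
   candidate realized at that step. LAR has joining candidates only. *)
Definition info (p : procedure) : Type :=
  match p with
  | FS => unit
  | LAR | Lasso => ({set candidate} * candidate)%type
  end.

Definition gen_model (I : Type) : Type :=
  k.-tuple (seq 'I_d * seq bool * I)%type.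

Definition model (p : procedure) : Type := gen_model (info p).

Definition active I (M : gen_model I) (l : nat) : seq 'I_d :=
  nth [::] ([::] :: [seq st.1.1 | st <- M]) l.

Definition active_signs I (M : gen_model I) (l : nat) : seq bool :=
  nth [::] ([::] :: [seq st.1.2 | st <- M]) l.

End Models.

Section ForwardStepwise.
Variables (R : rcfType) (d k : nat).
Implicit Type M : model d k FS.

Definition fs_possible M : Prop :=
  forall i : 'I_k,
    size (active_signs M i.+1) = size (active M i.+1) /\
    exists2 j, j \notin active M i & active M i.+1 = rcons (active M i) j.

Definition sqnorm n (v : 'cV[R]_n) : R := \sum_a v a 0 ^+ 2.

Definition fs_den n (X : 'M[R]_(n, d)) A j : R :=
  sqnorm (Pperp X A *m col j X).

(* The row X_j^T P / ||P X_j||^2, with P the projection for A. *)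
Definition fs_row n (X : 'M[R]_(n, d)) A j : 'rV[R]_n :=
  (fs_den X A j)^-1 *: ((col j X)^T *m Pperp X A).

Definition fs_regular n (X : 'M[R]_(n, d)) M : Prop :=
  forall i : 'I_k,
    gram X (active M i.+1) \in unitmx /\
    forall j, j \notin active M i -> fs_den X (active M i) j != 0.

(* For possible M, the index j below is the one entering at step i + 1. *)
Definition fs_selected n (X : 'M[R]_(n, d)) (y : 'cV[R]_n) M : Prop :=
  forall i : 'I_k,
    nonneg (signed_ls X (active M i.+1) (active_signs M i.+1) *m y) /\
    forall j j' (b : bool),
      j \in active M i.+1 -> j \notin active M i ->
      j' \notin active M i.+1 ->
      (-1) ^+ b * ((col j' X)^T *m Pperp X (active M i) *m y) 0 0
        / sqnorm (Pperp X (active M i) *m col j' X)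
      <= (-1) ^+ last false (active_signs M i.+1)
        * ((col j X)^T *m Pperp X (active M i) *m y) 0 0
        / sqnorm (Pperp X (active M i) *m col j X).

Definition fs_rows M : seq (design_row R d) :=
  flatten [seq
    signed_ls_rows R (active M i.+1) (active_signs M i.+1) ++
    [seq (fun n (X : 'M[R]_(n, d)) =>
            (-1) ^+ last false (active_signs M i.+1)
              *: fs_row X (active M i) t.1.1
            - (-1) ^+ t.2 *: fs_row X (active M i) t.1.2)
    | t : 'I_d * 'I_d * bool <- enum [set t : 'I_d * 'I_d * bool |
                  [&& t.1.1 \in active M i.+1, t.1.1 \notin active M i
                    & t.1.2 \notin active M i.+1]]]
  | i : 'I_k <- enum 'I_k].

End ForwardStepwise.

Section LeastAngleAndLasso.
Variables (R : rcfType) (d k : nat).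
Local Notation path_model := (gen_model d k ({set candidate d} * candidate d)).
Implicit Type M : path_model.
(* Whether crossing candidates are allowed: true for the lasso, false for
   LAR. *)
Variable crossing : bool.

Definition eligible M (i : 'I_k) : {set candidate d} := (tnth M i).2.1.

Definition event M (i : 'I_k) : candidate d := (tnth M i).2.2.

Definition update (S : seq ('I_d * bool)) (c : candidate d) :=
  match c with
  | inl q => rcons S q
  | inr j => [seq q <- S | q.1 != j]
  end.

(* The active list after l steps, each variable paired with its entry sign. *)
Definition state M (l : nat) : seq ('I_d * bool) :=
  foldl update [::] (take l [seq st.2.2 | st <- M]).

Definition last_event M (i : nat) : option (candidate d) :=
  if i is i'.+1 then onth [seq st.2.2 | st <- M] i' else None.

Definition just_joined M (i : nat) (j : 'I_d) : bool :=
  if last_event M i is Some (inl q) then q.1 == j else false.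

Definition just_left M (i : nat) (q : 'I_d * bool) : bool :=
  (last_event M i == Some (inr q.1)) && (q \in state M i.-1).

Definition candidates M (i : nat) : {set candidate d} :=
  [set c | match c with
           | inl q => (q.1 \notin unzip1 (state M i)) && ~~ just_left M i q
           | inr j => [&& crossing, j \in unzip1 (state M i)
                        & ~~ just_joined M i j]
           end].

(* Every candidate is eligible at the first step because the initial knot is
   +oo. *)
Definition path_possible M : Prop :=
  forall i : 'I_k,
    [/\ active M i.+1 = unzip1 (state M i.+1),
        size (active_signs M i.+1) = size (active M i.+1),
        eligible M i \subset candidates M i,
        event M i \in eligible M i &
        i = 0%N :> nat -> eligible M i = candidates M i].

Definition entry_signs (S : seq ('I_d * bool)) : 'cV[R]_(size (unzip1 S)) :=
  sign_col R (unzip2 S) _.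

(* The basis vector at the position of j in the duplicate-free list A. *)
Definition basis_at (A : seq 'I_d) (j : 'I_d) : 'cV[R]_(size A) :=
  \col_a (tnth (in_tuple A) a == j)%:R.

Definition cand_den n (X : 'M[R]_(n, d)) S (c : candidate d) : R :=
  let A := unzip1 S in
  match c with
  | inl (j, s) =>
      (-1) ^+ s
      - ((col j X)^T *m Xsub X A *m invmx (gram X A) *m entry_signs S) 0 0
  | inr j => ((basis_at A j)^T *m invmx (gram X A) *m entry_signs S) 0 0
  end.

(* The vectors c_l(j, s) and d_l(j). *)
Definition cand_vec n (X : 'M[R]_(n, d)) S (c : candidate d) : 'cV[R]_n :=
  let A := unzip1 S in
  (cand_den X S c)^-1 *:
  match c with
  | inl (j, _) => Pperp X A *m col j X
  | inr j => Xsub X A *m invmx (gram X A) *m basis_at A j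
  end.

Definition path_regular n (X : 'M[R]_(n, d)) M : Prop :=
  forall i : 'I_k,
    gram X (active M i.+1) \in unitmx /\
    forall c, c \in candidates M i -> cand_den X (state M i) c != 0.

Definition path_selected n (X : 'M[R]_(n, d)) (y : 'cV[R]_n) M : Prop :=
  exists2 lam : nat -> \bar R, lam 0%N = +oo%E &
  forall i : 'I_k,
    let v c := (dot (cand_vec X (state M i) c) y)%:E in
    nonneg (signed_ls X (active M i.+1) (active_signs M i.+1) *m y) /\
    [/\ forall c, c \in eligible M i -> (v c <= lam i)%E,
        forall c, c \in candidates M i :\: eligible M i -> (lam i <= v c)%E,
        lam i.+1 = v (event M i),
        forall c, c \in eligible M i -> (v c <= lam i.+1)%E &
        (0 <= lam i.+1 <= lam i)%E].

(* The inequality between consecutive knots is the eligibility row of the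
   event itself. *)
Definition path_rows M : seq (design_row R d) :=
  flatten [seq
    signed_ls_rows R (active M i.+1) (active_signs M i.+1) ++
    (if last_event M i is Some q then
       [seq (fun n (X : 'M[R]_(n, d)) =>
               (cand_vec X (state M i.-1) q - cand_vec X (state M i) c)^T)
       | c <- enum (eligible M i)] ++
       [seq (fun n (X : 'M[R]_(n, d)) =>
               (cand_vec X (state M i) c - cand_vec X (state M i.-1) q)^T)
       | c <- enum (candidates M i :\: eligible M i)]
     else [::]) ++
    [seq (fun n (X : 'M[R]_(n, d)) =>
            (cand_vec X (state M i) (event M i) - cand_vec X (state M i) c)^T)
    | c <- enum (eligible M i)] ++
    [:: (fun n (X : 'M[R]_(n, d)) => (cand_vec X (state M i) (event M i))^T)]
  | i : 'I_k <- enum 'I_k].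

End LeastAngleAndLasso.

Section Procedures.
Variables (R : rcfType) (d k : nat).

(* Membership in the finite set of possible models. *)
Definition possible (p : procedure) : model d k p -> Prop :=
  match p with
  | FS => @fs_possible d k
  | LAR => @path_possible d k false
  | Lasso => @path_possible d k true
  end.

(* All inverses and reciprocals in the conditions defining M exist. *)
Definition regular (p : procedure) n (X : 'M[R]_(n, d))
    : model d k p -> Prop :=
  match p with
  | FS => @fs_regular R d k n X
  | LAR => @path_regular R d k false n X
  | Lasso => @path_regular R d k true n X
  end.

(* The event that M is the selected model; several M may be selected in case
   of ties. *)
Definition selected (p : procedure) n (X : 'M[R]_(n, d)) (y : 'cV[R]_n)
    : model d k p -> Prop :=
  match p with
  | FS => @fs_selected R d k n X y
  | LAR => @path_selected R d k false n X y
  | Lasso => @path_selected R d k true n X y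
  end.

Definition selection_rows (p : procedure) : model d k p -> seq (design_row R d) :=
  match p with
  | FS => @fs_rows R d k
  | LAR => @path_rows R d k false
  | Lasso => @path_rows R d k true
  end.

Definition num_rows (p : procedure) (M : model d k p) : nat :=
  size (selection_rows M).

Definition selection_mx (p : procedure) (M : model d k p) n (X : 'M[R]_(n, d))
    : 'M[R]_(num_rows M, n) :=
  rows_mx (selection_rows M) X.

End Procedures.
Arguments num_rows R {d k p} M.

(* Main.v *)
(* Every row of Q_M(X) is f(X^T X) X^T for a function f not depending on n:
   each vector occurring in it has the form X h(X^T X). To make the coefficient
   depend on X^T X / n alone, apply this identity to the rescaled design
   X / sqrt n, whose Gram matrix is X^T X / n. When the Gram matrices of the
   active sets are invertible, every row is homogeneous in X, so the row at
   X / sqrt n is a positive multiple of the row at X. *)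

From Stdlib Require List.
Require Import Defs.
From HB Require Import structures.
From mathcomp Require Import all_boot all_order all_algebra.
From mathcomp Require Import constructive_ereal.
Set Implicit Arguments.
Unset Strict Implicit.
Unset Printing Implicit Defensive.
Import Order.TTheory GRing.Theory Num.Theory.
Local Open Scope ring_scope.

(** * Predicates along lists: [List.Forall] for propositional ones, [all] for boolean ones *)

Lemma Forall_cat (T : Type) (P : T -> Prop) (s1 s2 : seq T) :
  List.Forall P s1 -> List.Forall P s2 -> List.Forall P (s1 ++ s2).
Proof. by elim=> //= x s Px _ IH /IH; constructor. Qed.

Lemma Forall_map (I T : Type) (P : T -> Prop) (f : I -> T) (r : seq I) :
  (forall i, P (f i)) -> List.Forall P [seq f i | i <- r].
Proof. by move=> Pf; elim: r => [|i r IH] /=; constructor. Qed.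

Lemma Forall_flatten_map (I T : Type) (P : T -> Prop) (f : I -> seq T)
    (r : seq I) :
  (forall i, List.Forall P (f i)) -> List.Forall P (flatten [seq f i | i <- r]).
Proof.
by move=> Pf; elim: r => [|i r IH] /=; [constructor | apply: Forall_cat].
Qed.

Lemma Forall_tnth (T : Type) (P : T -> Prop) (s : seq T) (i : 'I_(size s)) :
  List.Forall P s -> P (tnth (in_tuple s) i).
Proof.
(* The entry itself serves as the default of [nth], since [T] comes with no chosen inhabitant. *)
move=> Ps; rewrite (tnth_nth (tnth (in_tuple s) i)) /=.
move: (tnth _ i) (ltn_ord i) => x0; move: (nat_of_ord i).
by elim: Ps => [|x s' Px _ IH] [|j] //=; apply: IH.
Qed.

Lemma all_map_enum (I : finType) (T : Type) (p : pred T) (f : I -> T)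
    (A : {pred I}) :
  all p [seq f i | i <- enum A] <-> forall i, i \in A -> p (f i).
Proof.
rewrite all_map; split=> [/allP Af i iA | Af].
  by apply: Af; rewrite mem_enum.
by apply/allP => i; rewrite mem_enum; apply: Af.
Qed.

Lemma all_flatten_enum (I : finType) (T : Type) (p : pred T)
    (f : I -> seq T) :
  all p (flatten [seq f i | i <- enum I]) <-> forall i, all p (f i).
Proof.
have -> : all p (flatten [seq f i | i <- enum I]) = all (all p \o f) (enum I).
  by elim: (enum I) => //= i r IH; rewrite all_cat IH.
split=> [/allP pf i | pf]; first by apply: pf; rewrite mem_enum.
by apply/allP => i _; apply: pf.
Qed.

(** * Rows that are a function of the Gram matrix times the transposed design *)

Section LinearAlgebra.
Variables (R : rcfType) (d : nat).
Implicit Types (A : seq 'I_d) (S : seq ('I_d * bool)) (j : 'I_d).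
Implicit Types (q : design_row R d).

(** [f] is fixed before [n] and [X], so one coefficient serves every sample size. *)
Definition gram_row q := exists f : 'M[R]_d -> 'rV[R]_d,
  forall n (X : 'M_(n, d)), q n X = f (X^T *m X) *m X^T.

(** These columns of the identity form a matrix E with X_A = X E, which puts the choice of columns
    to the right of [X] and makes [gram X A] a function of X^T X. *)
Definition selector A : 'M[R]_(d, size A) := Xsub 1%:M A.

Lemma Xsub_selector n (X : 'M[R]_(n, d)) A : Xsub X A = X *m selector A.
Proof. by rewrite /selector /Xsub mulmx_colsub mulmx1. Qed.

Lemma gram_selector n (X : 'M[R]_(n, d)) A :
  gram X A = (selector A)^T *m (X^T *m X) *m selector A.
Proof. by rewrite /gram Xsub_selector trmx_mul !mulmxA. Qed.

Lemma signed_ls_gram A s (a : 'I_(size A)) :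
  gram_row (fun n (X : 'M[R]_(n, d)) => row a (signed_ls X A s)).
Proof.
exists (fun G => row a (diag_mx (sign_col R s (size A))^T
  *m invmx ((selector A)^T *m G *m selector A) *m (selector A)^T)) => n X.
by rewrite -row_mul /signed_ls gram_selector Xsub_selector trmx_mul !mulmxA.
Qed.

(** With X_j = X e_j and X_A = X E, both terms of the projected column start with [X], and all
    further occurrences of [X] pair up into X^T X. *)
Lemma Pperp_col_gram A j :
  exists h : 'M[R]_d -> 'cV[R]_d, forall n (X : 'M_(n, d)),
    Pperp X A *m col j X = X *m h (X^T *m X).
Proof.
exists (fun G => col j 1%:M - selector A
  *m invmx ((selector A)^T *m G *m selector A) *m (selector A)^T *m G
  *m col j 1%:M) => n X.
rewrite /Pperp -gram_selector Xsub_selector trmx_mul.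
have -> : col j X = X *m col j 1%:M by rewrite !colE mul1mx.
by rewrite mulmxBl mulmxBr mul1mx !mulmxA.
Qed.

Lemma trPperp n (X : 'M[R]_(n, d)) A : (Pperp X A)^T = Pperp X A.
Proof.
rewrite /Pperp linearB /= tr_scalar_mx !trmx_mul trmxK trmx_inv mulmxA.
by rewrite /gram trmx_mul trmxK.
Qed.

Lemma sqnormE n (v : 'cV[R]_n) : sqnorm v = (v^T *m v) 0 0.
Proof. by rewrite /sqnorm mxE; apply: eq_bigr => a _; rewrite mxE expr2. Qed.

(** [Pperp] is symmetric, so the numerator is the transpose of P X_j = X h, whose squared norm is
    h^T G h with G = X^T X. *)
Lemma fs_row_gram A j : gram_row (fun n X => fs_row X A j).
Proof.
have [h hE] := Pperp_col_gram A j.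
exists (fun G => (((h G)^T *m G *m h G) 0 0)^-1 *: (h G)^T) => n X.
rewrite /fs_row /fs_den sqnormE -[in X in _ *: X]trPperp -trmx_mul hE.
by rewrite trmx_mul -scalemxAl !mulmxA.
Qed.

Lemma cand_vec_gram S c :
  exists h : 'M[R]_d -> 'cV[R]_d, forall n (X : 'M_(n, d)),
    cand_vec X S c = X *m h (X^T *m X).
Proof.
(* In both kinds of candidate the denominator contains [X] only through X^T X. *)
have [den denE] : exists den : 'M[R]_d -> R, forall n (X : 'M_(n, d)),
    cand_den X S c = den (X^T *m X).
  case: c => [[j s]|j].
    exists (fun G => (-1) ^+ s - ((col j 1%:M)^T *m G *m selector (unzip1 S)
      *m invmx ((selector (unzip1 S))^T *m G *m selector (unzip1 S))
      *m entry_signs R S) 0 0) => n X.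
    rewrite /cand_den -gram_selector Xsub_selector.
    have -> : col j X = X *m col j 1%:M by rewrite !colE mul1mx.
    by rewrite trmx_mul !mulmxA.
  exists (fun G => ((basis_at R (unzip1 S) j)^T
      *m invmx ((selector (unzip1 S))^T *m G *m selector (unzip1 S))
      *m entry_signs R S) 0 0) => n X.
  by rewrite /cand_den -gram_selector.
case: c denE => [[j s]|j] denE.
  have [h hE] := Pperp_col_gram (unzip1 S) j.
  exists (fun G => (den G)^-1 *: h G) => n X.
  by rewrite /cand_vec denE hE -scalemxAr.
exists (fun G => (den G)^-1 *: (selector (unzip1 S)
  *m invmx ((selector (unzip1 S))^T *m G *m selector (unzip1 S))
  *m basis_at R (unzip1 S) j)) => n X.
by rewrite /cand_vec denE -gram_selector Xsub_selector -scalemxAr !mulmxA.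
Qed.

Lemma gram_rowZ a q : gram_row q -> gram_row (fun n X => a *: q n X).
Proof.
by case=> f fE; exists (fun G => a *: f G) => n X; rewrite fE scalemxAl.
Qed.

Lemma gram_rowB q1 q2 :
  gram_row q1 -> gram_row q2 -> gram_row (fun n X => q1 n X - q2 n X).
Proof.
move=> [f fE] [g gE]; exists (fun G => f G - g G) => n X.
by rewrite fE gE mulmxBl.
Qed.

Lemma cand_row_gram S c : gram_row (fun n X => (cand_vec X S c)^T).
Proof.
have [h hE] := cand_vec_gram S c.
by exists (fun G => (h G)^T) => n X; rewrite hE trmx_mul.
Qed.

Lemma cand_rowB_gram S c S' c' :
  gram_row (fun n X => (cand_vec X S c - cand_vec X S' c')^T).
Proof.
have [f fE] := gram_rowB (cand_row_gram S c) (cand_row_gram S' c').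
by exists f => n X; rewrite linearB fE.
Qed.

(** * Homogeneity under rescaling of the design *)

Section Scaling.

Lemma mulmxZZ m n p (a b : R) (A : 'M[R]_(m, n)) (B : 'M_(n, p)) :
  (a *: A) *m (b *: B) = (a * b) *: (A *m B).
Proof. by rewrite -scalemxAl -scalemxAr scalerA. Qed.

Lemma trmxZ m n (a : R) (A : 'M[R]_(m, n)) : (a *: A)^T = a *: A^T.
Proof. exact: linearZ. Qed.

Variables (n : nat) (X : 'M[R]_(n, d)) (a : R).
Hypothesis a_neq0 : a != 0.

Lemma colZ j : col j (a *: X) = a *: col j X.
Proof. exact: linearZ. Qed.

Lemma XsubZ A : Xsub (a *: X) A = a *: Xsub X A.
Proof. by rewrite !Xsub_selector scalemxAl. Qed.

(** Invertibility matters: [invmx] returns a singular matrix unchanged, which would scale by a^2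
    instead. *)
Lemma invmx_gramZ A : gram X A \in unitmx ->
  invmx (gram (a *: X) A) = a ^- 2 *: invmx (gram X A).
Proof.
move=> uX; rewrite /gram XsubZ trmxZ mulmxZZ -expr2 invmxZ //.
by rewrite unitmxZ // unitfE expf_neq0.
Qed.

(** The factors a, a^-2 and a cancel: the projection depends only on the span of the columns. *)
Lemma PperpZ A : gram X A \in unitmx -> Pperp (a *: X) A = Pperp X A.
Proof.
move=> uX; rewrite /Pperp invmx_gramZ // XsubZ trmxZ !mulmxZZ.
by rewrite mulrAC -expr2 divff ?scale1r // expf_neq0.
Qed.

Lemma signed_lsZ A s : gram X A \in unitmx ->
  signed_ls (a *: X) A s = a^-1 *: signed_ls X A s.
Proof.
move=> uX; rewrite /signed_ls invmx_gramZ // XsubZ trmxZ.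
by rewrite -!scalemxAr -scalemxAl scalerA expr2 invfM mulVKf.
Qed.

(** The numerator has degree 1 in [X] and the squared norm degree 2. *)
Lemma fs_rowZ A j : gram X A \in unitmx ->
  fs_row (a *: X) A j = a^-1 *: fs_row X A j.
Proof.
move=> uX; rewrite /fs_row /fs_den !sqnormE PperpZ // colZ -scalemxAr.
rewrite !trmxZ mulmxZZ -scalemxAl !scalerA mxE !invfM.
by rewrite mulrAC mulfVK.
Qed.

(** A joining vector has degree 1 over degree 0, a crossing vector degree -1 over degree -2. Both
    thus have degree 1, so their differences scale by a single factor. *)
Lemma cand_vecZ S c : gram X (unzip1 S) \in unitmx ->
  cand_vec (a *: X) S c = a *: cand_vec X S c.
Proof.
move=> uX; case: c => [[j s]|j]; rewrite /cand_vec /cand_den.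
  rewrite PperpZ // colZ XsubZ invmx_gramZ // trmxZ !mulmxZZ -scalemxAl.
  by rewrite -expr2 divff ?expf_neq0 // scale1r -scalemxAr !scalerA mulrC.
rewrite XsubZ invmx_gramZ // -scalemxAr mulmxZZ -!scalemxAl mxE !scalerA.
rewrite invfM invrK mulrC mulrA divfK ?expf_neq0 //.
Qed.
End Scaling.
End LinearAlgebra.

(** * Selection as a list of linear inequalities *)

Section Rows.
Variables (R : rcfType) (d k : nat).
Implicit Types (q : design_row R d).

Definition row_holds n (X : 'M[R]_(n, d)) (y : 'cV[R]_n) q : bool :=
  0 <= (q n X *m y) 0 0.

Lemma entryB m n (A B : 'M[R]_(m, n)) a b : (A - B) a b = A a b - B a b.
Proof. by rewrite !mxE. Qed.

Lemma entryZ m n c (A : 'M[R]_(m, n)) a b : (c *: A) a b = c * A a b.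
Proof. by rewrite mxE. Qed.

Lemma nonneg_rows_mx n (X : 'M[R]_(n, d)) y (L : seq (design_row R d)) :
  nonneg (rows_mx L X *m y) <-> all (row_holds X y) L.
Proof.
have rowsE (i : 'I_(size L)) :
    (rows_mx L X *m y) i 0 = (tnth (in_tuple L) i n X *m y) 0 0.
  by rewrite !mxE; apply: eq_bigr => a _; rewrite mxE.
split=> [Ly | /(@all_tnthP _ _ _ (in_tuple L)) Ly i].
  by apply/(@all_tnthP _ _ _ (in_tuple L)) => i; rewrite /row_holds -rowsE.
by rewrite rowsE; apply: Ly.
Qed.

Lemma signed_ls_rows_hold n (X : 'M[R]_(n, d)) y A s :
  all (row_holds X y) (signed_ls_rows R A s) <-> nonneg (signed_ls X A s *m y).
Proof.
apply: (iff_trans (all_map_enum _ _ _)).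
split=> Ly a; last by move=> _; rewrite /row_holds -row_mul mxE; apply: Ly.
by have := Ly a isT; rewrite /row_holds -row_mul mxE.
Qed.

Lemma row_holds_cand n (X : 'M[R]_(n, d)) y S c :
  row_holds X y (fun n X => (cand_vec X S c)^T) = (0 <= dot (cand_vec X S c) y).
Proof. by []. Qed.

Lemma row_holds_candB n (X : 'M[R]_(n, d)) y S c S' c' :
  row_holds X y (fun n X => (cand_vec X S' c' - cand_vec X S c)^T) =
  (dot (cand_vec X S c) y <= dot (cand_vec X S' c') y).
Proof.
by rewrite /row_holds linearB mulmxBl entryB subr_ge0.
Qed.

Lemma row_holds_fs n (X : 'M[R]_(n, d)) y A j j' (s b : bool) :
  row_holds X y (fun n X =>
    (-1) ^+ s *: fs_row X A j - (-1) ^+ b *: fs_row X A j') =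
  ((-1) ^+ b * ((col j' X)^T *m Pperp X A *m y) 0 0
     / sqnorm (Pperp X A *m col j' X)
   <= (-1) ^+ s * ((col j X)^T *m Pperp X A *m y) 0 0
     / sqnorm (Pperp X A *m col j X)).
Proof.
rewrite /row_holds mulmxBl entryB subr_ge0.
rewrite /fs_row /fs_den !scalerA -!scalemxAl.
by rewrite !entryZ !(mulrAC _ _^-1).
Qed.

Lemma fs_selected_rows n (X : 'M[R]_(n, d)) y (M : model d k FS) :
  fs_selected X y M <-> all (row_holds X y) (fs_rows R M).
Proof.
rewrite all_flatten_enum; split=> sel i.
  have [ls cmp] := sel i; rewrite all_cat; apply/andP; split.
    exact/signed_ls_rows_hold.
  apply/all_map_enum => -[[j j'] b]; rewrite inE row_holds_fs /=.
  by case/and3P => jA jA' j'A; apply: cmp.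
have := sel i; rewrite all_cat.
case/andP=> [/signed_ls_rows_hold ls /all_map_enum cmp].
split=> // j j' b jA jA' j'A.
by have := cmp (j, j', b); rewrite inE row_holds_fs /= jA jA' j'A; apply.
Qed.

(** This separates the first step, with knot +oo and empty active list, from the later ones, whose
    predecessor is again a step to which hypotheses on all steps apply. *)
Lemma ord_predP (i : 'I_k) :
  (i = 0%N :> nat) \/ exists i' : 'I_k, i = i'.+1 :> nat.
Proof.
case: i => [[|i] ltik]; first by left.
by right; exists (Ordinal (ltnW ltik)).
Qed.

(** * Elimination of the knots for LAR and the lasso *)

Section Path.
Variable (crossing : bool).
Local Notation path_model := (gen_model d k ({set candidate d} * candidate d)).
Implicit Type M : path_model.

Lemma last_eventS M (i i' : 'I_k) :
  i = i'.+1 :> nat -> last_event M i = Some (event M i').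
Proof.
move=> ->; rewrite /last_event /event (tnth_nth (tnth M i')).
by rewrite onthE -map_comp (nth_map (tnth M i')) ?size_tuple.
Qed.

(** Each knot after the initial one equals the value of the event of its step, so a comparison with
    a knot becomes a comparison with the preceding event. *)
Lemma path_selected_rows n (X : 'M[R]_(n, d)) y M :
  path_possible crossing M ->
  path_selected crossing X y M <-> all (row_holds X y) (path_rows R crossing M).
Proof.
move=> poss; rewrite all_flatten_enum; split=> [[lam lam0 sel] i | sel].
  have [ls [el inel lamE lamM /andP[lam_ge0 _]]] := sel i.
  rewrite !all_cat; apply/and4P; split.
  - exact/signed_ls_rows_hold.
  - case: (ord_predP i) => [-> // | [i' iE]].
    have [_ [_ _ lamE' _ _]] := sel i'.
    rewrite (last_eventS _ iE) all_cat.
    apply/andP; split; apply/all_map_enum => c cM;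
      rewrite row_holds_candB -lee_fin [in state _ i.-1]iE -lamE' -iE.
      exact: el.
    exact: inel.
  - apply/all_map_enum => c cM; rewrite row_holds_candB -lee_fin -lamE.
    exact: lamM.
  - by rewrite /= andbT row_holds_cand -lee_fin -lamE.
(* The knots are rebuilt from the events; [insub] turns a number into a step, and the value 0 beyond
   step [k] is arbitrary. *)
pose lam l := if l is l'.+1 then
  if (insub l' : option 'I_k) is Some i then
    (dot (cand_vec X (state M i) (event M i)) y)%:E else 0%E else +oo%E.
have lamS (i : 'I_k) :
    lam i.+1 = (dot (cand_vec X (state M i) (event M i)) y)%:E.
  by rewrite /lam valK.
exists lam => // i v; have := sel i; rewrite !all_cat.
case/and4P=> /signed_ls_rows_hold ls prev /all_map_enum lamM.
rewrite all_seq1 row_holds_cand => lam_ge0; split=> //.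
have [_ _ _ evM init] := poss i.
(* Proved ahead because, applied to the event, it also yields the decrease of the knots. *)
have el c : c \in eligible M i -> (v c <= lam i)%E.
  case: (ord_predP i) => [-> | [i' iE]] cM; first by rewrite leey.
  have lamE : lam i = _ := etrans (congr1 lam iE) (lamS i').
  have stE : state M i.-1 = state M i' by rewrite iE.
  move: prev; rewrite lamE (last_eventS _ iE) stE all_cat.
  case/andP=> [/all_map_enum/(_ c cM) cle _].
  by rewrite lee_fin -row_holds_candB.
split=> //.
(* At the first step every candidate is eligible, so no ineligible one has to exceed +oo. *)
- move=> c; case: (ord_predP i) => [/init -> | [i' iE]].
    by rewrite setDv inE.
  have lamE : lam i = _ := etrans (congr1 lam iE) (lamS i').
  have stE : state M i.-1 = state M i' by rewrite iE.
  move: prev; rewrite lamE (last_eventS _ iE) stE all_cat.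
  case/andP=> [_ /all_map_enum cle] cM.
  by rewrite lee_fin -row_holds_candB; apply: cle.
- by move=> c cM; rewrite lamS lee_fin -row_holds_candB; apply: lamM.
- by rewrite lamS lee_fin lam_ge0 /= el.
Qed.
End Path.

Lemma selected_rows p n (X : 'M[R]_(n, d)) y (M : model d k p) :
  possible M -> selected X y M <-> all (row_holds X y) (selection_rows R M).
Proof.
case: p M => M poss; first exact: fs_selected_rows.
  exact: path_selected_rows.
exact: path_selected_rows.
Qed.

(** * Gram form and rescaling of all selection rows *)

Lemma selection_rows_gram p (M : model d k p) :
  List.Forall (@gram_row R d) (selection_rows R M).
Proof.
(* With [crossing] arbitrary, one argument covers both LAR and the lasso. *)
have path_gram crossing (M' : gen_model d k _) :
    List.Forall (@gram_row R d) (path_rows R crossing M').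
  apply: Forall_flatten_map => i; apply: Forall_cat.
    by apply: Forall_map => a; apply: signed_ls_gram.
  apply: Forall_cat.
    case: last_event => [c|]; last by constructor.
    by apply: Forall_cat; apply: Forall_map => c'; apply: cand_rowB_gram.
  apply: Forall_cat; first by apply: Forall_map => c; apply: cand_rowB_gram.
  by constructor; [exact: cand_row_gram | constructor].
case: p M => M; [ | exact: path_gram ..].
apply: Forall_flatten_map => i; apply: Forall_cat.
  by apply: Forall_map => a; apply: signed_ls_gram.
apply: Forall_map => t; apply: gram_rowB; apply: gram_rowZ; exact: fs_row_gram.
Qed.

(** The factor may differ from row to row, as positive row scaling permits. *)
Definition rescalable n (X : 'M[R]_(n, d)) (a : R) q : Prop :=
  exists2 c, 0 < c & q n (a *: X) = c *: q n X.

Lemma gram_active_unit I n (X : 'M[R]_(n, d)) (M : gen_model d k I) :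
  (forall i : 'I_k, gram X (active M i.+1) \in unitmx) ->
  forall i : 'I_k, gram X (active M i) \in unitmx.
Proof.
move=> uX i; case: (ord_predP i) => [-> | [i' ->]]; last exact: uX.
(* The Gram matrix of the empty list is 0 by 0, with determinant 1. *)
by rewrite unitmxE det_mx00 unitr1.
Qed.

(** All terms within a row have the same degree in [X]: -1 for coefficient signs and FS comparisons,
    1 for rows built from candidate vectors. The factor is accordingly [a^-1] or [a]. *)
Lemma selection_rowsZ p n (X : 'M[R]_(n, d)) (a : R) (M : model d k p) :
  0 < a -> possible M -> regular X M ->
  List.Forall (rescalable X a) (selection_rows R M).
Proof.
move=> a_gt0; have a_neq0 := lt0r_neq0 a_gt0.
have ls_scale A s : gram X A \in unitmx ->
    List.Forall (rescalable X a) (signed_ls_rows R A s).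
  move=> uX; apply: Forall_map => b; exists a^-1; first by rewrite invr_gt0.
  by rewrite signed_lsZ // linearZ.
have path_scale crossing (M' : gen_model d k _) :
    path_possible crossing M' -> path_regular crossing X M' ->
    List.Forall (rescalable X a) (path_rows R crossing M').
  move=> poss reg.
  (* Regularity concerns the active lists of the model, whereas candidate vectors use the replayed
     state; possibility of the model identifies the two. *)
  have uS (i : 'I_k) : gram X (unzip1 (state M' i)) \in unitmx.
    case: (ord_predP i) => [-> | [i' iE]].
      by rewrite /state take0 unitmxE det_mx00 unitr1.
    by rewrite iE; have [<- _ _ _ _] := poss i'; have [] := reg i'.
  (* At the first step [i.-1] is 0 as well, so the state is still the empty one. *)
  have uSp (i : 'I_k) : gram X (unzip1 (state M' i.-1)) \in unitmx.
    case: (ord_predP i) => [i0 | [i' iE]]; last by rewrite iE; exact: uS i'.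
    by have := uS i; rewrite i0.
  have candB S c S' c' : gram X (unzip1 S) \in unitmx ->
      gram X (unzip1 S') \in unitmx ->
      rescalable X a (fun n X => (cand_vec X S c - cand_vec X S' c')^T).
    by move=> uXS uXS'; exists a => //; rewrite !cand_vecZ // -scalerBr trmxZ.
  apply: Forall_flatten_map => i; have [uXi _] := reg i.
  apply: Forall_cat; first exact: ls_scale.
  apply: Forall_cat.
    case: last_event => [c|]; last by constructor.
    by apply: Forall_cat; apply: Forall_map => c'; apply: candB.
  apply: Forall_cat; first by apply: Forall_map => c; apply: candB.
  constructor; last by constructor.
  by exists a => //; rewrite cand_vecZ // trmxZ.
case: p M => M; [ | exact: path_scale ..].
move=> _ reg; have uX := gram_active_unit (fun i => (reg i).1).
apply: Forall_flatten_map => i; have [uXi _] := reg i.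
apply: Forall_cat; first exact: ls_scale.
apply: Forall_map => t; exists a^-1; first by rewrite invr_gt0.
by rewrite !fs_rowZ // scalerBr !scalerA ![a^-1 * _]mulrC.
Qed.

(** * From single rows to the selection matrix *)

Lemma gram_rows_mx (L : seq (design_row R d)) :
  List.Forall (@gram_row R d) L ->
  exists P : 'M[R]_d -> 'M[R]_(size L, d), forall n (X : 'M[R]_(n, d)),
    rows_mx L X = P (X^T *m X) *m X^T.
Proof.
move=> gL.
(* The rows are finite in number, so their coefficient functions can be chosen together without an
   axiom of choice. *)
have [f fE] := fin_all_exists (fun i : 'I_(size L) => Forall_tnth i gL).
exists (fun G => \matrix_i f i G) => n X; apply/row_matrixP => i.
by rewrite row_mul !rowK fE.
Qed.

Lemma rows_mxZ n (X : 'M[R]_(n, d)) a (L : seq (design_row R d)) :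
  List.Forall (rescalable X a) L ->
  same_up_to_pos_row_scaling (rows_mx L X) (rows_mx L (a *: X)).
Proof.
move=> sL; have tn (i : 'I_(size L)) : exists c : R,
    0 < c /\ tnth (in_tuple L) i n (a *: X) = c *: tnth (in_tuple L) i n X.
  by have [c] := Forall_tnth i sL; exists c.
have [c cE] := fin_all_exists tn.
exists (\row_i c i) => [i|]; first by rewrite mxE; have [] := cE i.
apply/row_matrixP => i; have [_ cEi] := cE i.
by apply/rowP => b; rewrite row_mul row_diag_mx -scalemxAl -rowE !rowK cEi !mxE.
Qed.

Lemma nonneg_pos_row_scaling m n (Q Q' : 'M[R]_(m, n)) (y : 'cV[R]_n) :
  same_up_to_pos_row_scaling Q Q' -> nonneg (Q *m y) <-> nonneg (Q' *m y).
Proof.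
case=> c c_gt0 ->; rewrite -mulmxA mul_diag_mx.
by split=> Qy i; have := Qy i; rewrite [in X in _ -> X]mxE ?mxE pmulr_rge0.
Qed.
End Rows.

Theorem lemma3 (R : rcfType) (p : procedure) (d k : nat) (hk : (1 <= k)%N) :
  (exists F : 'M[R]_d * 'cV[R]_d -> model d k p -> Prop,
     forall (n : nat) (X : 'M[R]_(n, d)) (y : 'cV[R]_n) (M : model d k p),
       (0 < n)%N -> possible M -> regular X M ->
       (selected X y M <-> F (master_statistic X y) M)) /\
  (forall M : model d k p, possible M ->
     exists P : 'M[R]_d -> 'M[R]_(num_rows R M, d),
     forall (n : nat) (X : 'M[R]_(n, d)), (0 < n)%N -> regular X M ->
       same_up_to_pos_row_scaling (selection_mx M X)
         (P (n%:R^-1 *: (X^T *m X)) *m ((Num.sqrt n%:R)^-1 *: X^T)) /\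
       (forall y : 'cV[R]_n,
          (selected X y M <-> nonneg (selection_mx M X *m y)) /\
          (selected X y M <->
             nonneg (P (n%:R^-1 *: (X^T *m X))
                       *m ((Num.sqrt n%:R)^-1 *: (X^T *m y)))))).
Proof.
(* The matrix form comes first, since dependence on the master statistic follows from it. *)
have detail_first (A B : Prop) : B -> (B -> A) -> A /\ B by tauto.
apply: detail_first => [M poss | detail].
- have [P PE] := gram_rows_mx (selection_rows_gram R M).
  exists P => n X n_gt0 reg; set r := (Num.sqrt n%:R)^-1.
  have r_gt0 : 0 < r by rewrite invr_gt0 sqrtr_gt0 ltr0n.
  have scal : same_up_to_pos_row_scaling (selection_mx M X)
      (P (n%:R^-1 *: (X^T *m X)) *m (r *: X^T)).
    (* As r^2 = 1/n, the argument of [P] is the Gram matrix of [r *: X], so [PE] identifies the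
       product with the rows at the rescaled design. *)
    have -> : n%:R^-1 *: (X^T *m X) = (r *: X)^T *m (r *: X).
      by rewrite trmxZ mulmxZZ -invfM -expr2 sqr_sqrtr // ler0n.
    by rewrite -trmxZ -PE; apply: rows_mxZ; apply: selection_rowsZ.
  have sel y : selected X y M <-> nonneg (selection_mx M X *m y).
    apply: (iff_trans (selected_rows X y poss)).
    exact: iff_sym (nonneg_rows_mx X y _).
  split=> // y; split=> //; apply: (iff_trans (sel y)).
  by rewrite [_ *: (X^T *m y)]scalemxAl mulmxA; apply: nonneg_pos_row_scaling.
(* [F] holds when some regular data set, of any positive sample size, has statistic [om] and selects
   [M]. It remains to see that the choice of data set is immaterial. *)
- exists (fun om M => exists n (X : 'M[R]_(n, d)) y,
    [/\ (0 < n)%N, regular X M, master_statistic X y = om & selected X y M]).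
  move=> n X y M n_gt0 poss reg.
  split=> [sel | [n' [X' [y' [n'_gt0 reg' []]]]]].
    by exists n, X, y.
  rewrite /scaled_gram /scaled_score => EG Es.
  (* The same [P] serves both sample sizes [n] and [n'], so equal statistics give equal
     inequalities. *)
  have [P PE] := detail M poss.
  have [_ /(_ y)[_ selE]] := PE n X n_gt0 reg.
  have [_ /(_ y')[_ selE']] := PE n' X' n'_gt0 reg'.
  by rewrite selE' selE EG Es.
Qed.
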